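(* For any lattice $\mathcal{L} \subset \mathbb{R}^n$, sublattice $\mathcal{M} \subseteq \mathcal{L}$, and vector $\mathbf{x} \in \mathbb{R}^n$, \[ f_{\mathcal{M}}(\mathbf{x}) \leq f_{\mathcal{L}}(\mathbf{x}) . \]
   Context: A lattice $\mathcal{L}\subset\mathbb{R}^n$ is the set of all integer linear combinations of $n$ linearly independent vectors of $\mathbb{R}^n$. A sublattice of $\mathcal{L}$ is an additive subgroup of $\mathcal{L}$ (not necessarily of full rank $n$). For $\mathbf{x}\in\mathbb{R}^n$, $\rho(\mathbf{x}) = \exp(-\pi \|\mathbf{x}\|^2)$ with $\|\cdot\|$ the Euclidean norm, and for a discrete set $A\subset\mathbb{R}^n$, $\rho(A) = \sum_{\mathbf{w}\in A}\rho(\mathbf{w})$. For $\mathcal{K}$ equal to $\mathcal{L}$ or a sublattice of it, the periodic Gaussian function is $f_{\mathcal{K}}(\mathbf{x}) = \rho(\mathcal{K}+\mathbf{x})/\rho(\mathcal{K})$, defined for all $\mathbf{x}\in\mathbb{R}^n$. *)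

(* Defs.v *)
From mathcomp Require Import all_boot all_order all_algebra.
From mathcomp Require Import all_classical all_reals all_analysis.

Set Implicit Arguments.
Unset Strict Implicit.
Unset Printing Implicit Defensive.

Import Order.TTheory GRing.Theory Num.Theory.

Local Open Scope classical_set_scope.
Local Open Scope ring_scope.

(* The canonical norm on 'rV[R]_n in MathComp-Analysis is the sup norm, hence
   this separate definition. *)
Definition euclidean_norm (R : realType) (n : nat) (x : 'rV[R]_n) : R :=
  Num.sqrt (\sum_(i < n) x ord0 i ^+ 2).

(* The rows of B are the n linearly independent basis vectors. *)
Definition is_lattice (R : realType) (n : nat) (L : set 'rV[R]_n) : Prop :=
  exists2 B : 'M[R]_n, row_free B &
    L = [set \sum_(i < n) (z i)%:~R *: row i B | z in [set: 'I_n -> int]].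

Definition is_sublattice (R : realType) (n : nat) (M L : set 'rV[R]_n) : Prop :=
  M `<=` L /\ zmod_closed (mem M).

Definition gaussian (R : realType) (n : nat) (x : 'rV[R]_n) : R :=
  expR (- pi * euclidean_norm x ^+ 2).

Definition gaussian_mass (R : realType) (n : nat) (A : set 'rV[R]_n) : \bar R :=
  (\esum_(w in A) (gaussian w)%:E)%E.

(* Both masses are finite when K is a sublattice of a lattice, and the
   denominator is positive (it is at least gaussian 0 = 1), so neither [fine]
   nor the division falls back on a default value there. *)
Definition periodic_gaussian (R : realType) (n : nat) (K : set 'rV[R]_n)
    (x : 'rV[R]_n) : R :=
  fine (gaussian_mass [set w + x | w in K]) / fine (gaussian_mass K).

(* Main.v *)
(* Write rho(K) for the Gaussian mass of a set K and G(z) = exp(-pi |z|^2 / 2).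
   By the parallelogram law rho(w+a) rho(m+b) = G(s+a+b) G(t+a-b) with s = w+m
   and t = w-m.  As (w, m) ranges over L x M, the pair (s, t) ranges over the
   pairs in L that are congruent modulo 2M, so
     rho(L+a) rho(M+b) = sum over s = t mod 2M of G(s+a+b) G(t+a-b).
   The kernel [s = t mod 2M] is positive semidefinite, hence (AM-GM on each
   coset of 2M)
     2 rho(L) rho(M+x) <= rho(L+x) rho(M) + rho(L-x) rho(M),
   and rho(L-x) = rho(L+x). *)
Require Import Defs.
From mathcomp Require Import all_boot all_order all_algebra.
From mathcomp Require Import all_classical all_reals all_analysis.
From mathcomp Require Import ring lra.

Set Implicit Arguments.
Unset Strict Implicit.
Unset Printing Implicit Defensive.

Import Order.TTheory GRing.Theory Num.Theory.

Local Open Scope classical_set_scope.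
Local Open Scope ring_scope.

(** * Sums of nonnegative extended reals *)

Section NonnegativeSums.
Variable R : realType.
Local Open Scope ereal_scope.

Lemma ge0_esumZl (T : choiceType) (I : set T) (c : \bar R) (f : T -> \bar R) :
  0 <= c -> (forall i, 0 <= f i) ->
  \esum_(i in I) (c * f i) = c * \esum_(i in I) f i.
Proof.
have le (d : \bar R) (g : T -> \bar R) : 0 <= d -> (forall i, 0 <= g i) ->
    \esum_(i in I) (d * g i) <= d * \esum_(i in I) g i.
  move=> d0 g0; apply: ge_ereal_sup => _ [X [finX XI] <-].
  rewrite -ge0_mule_fsumr//; apply: lee_wpmul2l => //.
  by apply: ereal_sup_ubound; exists X.
move=> c0 f0; apply/eqP; rewrite eq_le le//=.
case: c c0 => [c||//] c0.
- have [->|c_neq0] := eqVneq c 0%R.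
    by rewrite mul0e esum_ge0// => i _; rewrite mul0e.
  have cgt0 : (0 < c)%R by rewrite lt_def c_neq0 -lee_fin.
  have cV (t : \bar R) : c^-1%:E * (c%:E * t) = t.
    by rewrite muleA -EFinM mulVf ?gt_eqF// mul1e.
  (* For finite positive [c], the reverse inequality is [le] for the scalar [c^-1] and the family
     [c * f]. *)
  have := @le c^-1%:E (fun i => c%:E * f i).
  rewrite (eq_esum (b := f)); last by move=> i _; exact: cV.
  rewrite lee_fin invr_ge0 ltW// => /(_ isT) h.
  rewrite -[leRHS]mul1e -(mulfV c_neq0) EFinM -muleA lee_wpmul2l//.
  by apply: h => i; exact: mule_ge0.
(* For [c = +oo], either every term vanishes or a single nonzero term already makes the left side
   infinite. *)
- have [f0I|] := pselect (forall i, I i -> f i = 0).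
    by rewrite [X in _ * X]esum1// mule0 esum_ge0// => i _; exact: mule_ge0.
  move=> /existsNP[i /not_implyP[Ii /eqP fi0]].
  apply: le_trans (leey _) _; apply: (@esum_ge _ _ _ _ +oo).
  exists [set i]; first by split; [exact: finite_set1|move=> _ ->].
  by rewrite fsbig_set1 gt0_mulye// lt_def fi0 f0.
Qed.

Lemma ge0_esumZr (T : choiceType) (I : set T) (c : \bar R) (f : T -> \bar R) :
  0 <= c -> (forall i, 0 <= f i) ->
  \esum_(i in I) (f i * c) = (\esum_(i in I) f i) * c.
Proof.
move=> c0 f0; rewrite [RHS]muleC -ge0_esumZl//.
by apply: eq_esum => i _; rewrite muleC.
Qed.

Lemma exchange_esum (T1 T2 : choiceType) (I : set T1) (J : set T2)
    (a : T1 -> T2 -> \bar R) : (forall i j, 0 <= a i j) ->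
  \esum_(i in I) \esum_(j in J) a i j = \esum_(j in J) \esum_(i in I) a i j.
Proof.
move=> a0; rewrite !esum_esum//.
rewrite (reindex_esum (J `*`` fun=> I) _ (fun x => (x.2, x.1)))//; split=> //=.
- by move=> [i j] [].
- by move=> [i1 i2] [j1 j2] /= _ _ [] -> ->.
- by move=> [i j] [Ii Jj] /=; exists (j, i).
Qed.

Lemma mule_double_le_sqr (a b : \bar R) : 0 <= a -> 0 <= b ->
  a * b + a * b <= a * a + b * b.
Proof.
case: a => [a||//] a0; case: b => [b||//] b0;
  rewrite ?mulyy ?addye ?addey ?leey//.
by rewrite -!EFinM -!EFinD lee_fin; have := sqr_ge0 (a - b); nra.
Qed.

End NonnegativeSums.

(** * Sums over cosets of a subgroup and positivity of the coset kernel *)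

Section CosetSums.
Variables (R : realType) (V : zmodType).
Implicit Types (K L P : set V) (f g : V -> \bar R).
Local Open Scope ereal_scope.

Lemma mem_zmod_closedN K : zmod_closed (mem K) -> forall u, K u -> K (- u)%R.
Proof.
move=> [/[!inE]K0 KB] u Ku.
by move: (KB 0%R u); rewrite !inE sub0r; exact.
Qed.

Lemma mem_zmod_closedD K : zmod_closed (mem K) ->
  forall u v, K u -> K v -> K (u + v)%R.
Proof.
move=> Kz u v Ku /(mem_zmod_closedN Kz) Kv; case: Kz => _ KB.
by move: (KB u (- v)%R); rewrite !inE opprK; exact.
Qed.

Lemma esum_shift K f v : zmod_closed (mem K) -> K v ->
  \esum_(w in K) f (w + v)%R = \esum_(w in K) f w.
Proof.
move=> Kz Kv; rewrite [RHS](reindex_esum K _ (fun w => w + v)%R)//; split.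
- by move=> w Kw /=; exact: mem_zmod_closedD.
- by move=> w z _ _ /addIr.
- move=> w Kw; exists (w - v)%R; last by rewrite subrK.
  by apply: mem_zmod_closedD => //; exact: mem_zmod_closedN.
Qed.

Lemma esum_opp K f : zmod_closed (mem K) ->
  \esum_(w in K) f (- w)%R = \esum_(w in K) f w.
Proof.
move=> Kz; rewrite [RHS](reindex_esum K _ -%R)//; split.
- by move=> w Kw /=; exact: mem_zmod_closedN.
- by move=> w z _ _ /oppr_inj.
- by move=> w Kw; exists (- w)%R; [exact: mem_zmod_closedN|rewrite opprK].
Qed.

(** As an operator on [f], this is the kernel that equals 1 when [s] and [t] are congruent modulo
    [P] and 0 otherwise. *)
Definition coset_sum P f (s : V) : \bar R := \esum_(p in P) f (s + p)%R.

Lemma coset_sum_ge0 P f s : (forall z, 0 <= f z) -> 0 <= coset_sum P f s.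
Proof. by move=> f0; exact: esum_ge0. Qed.

Lemma coset_sum_shift P f s p : zmod_closed (mem P) -> P p ->
  coset_sum P f (s + p)%R = coset_sum P f s.
Proof.
move=> Pz Pp; rewrite /coset_sum.
rewrite -[RHS](esum_shift (fun w => f (s + w)%R) Pz Pp).
by apply: eq_esum => w _; rewrite -addrA (addrC p).
Qed.

(** The congruence kernel is symmetric: exchange the sums, replace [p] by [- p], and translate [s]
    by [p], which preserves [L] because [P] lies in [L]. *)
Lemma coset_sum_adjoint L P f g : zmod_closed (mem L) -> zmod_closed (mem P) ->
  P `<=` L -> (forall z, 0 <= f z) -> (forall z, 0 <= g z) ->
  \esum_(s in L) f s * coset_sum P g s = \esum_(s in L) coset_sum P f s * g s.
Proof.
move=> Lz Pz PL f0 g0.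
under eq_esum do rewrite -ge0_esumZl//.
rewrite exchange_esum; last by move=> *; exact: mule_ge0.
under [RHS]eq_esum do rewrite -ge0_esumZr//.
rewrite [RHS]exchange_esum; last by move=> *; exact: mule_ge0.
rewrite -[RHS](esum_opp _ Pz); apply: eq_esum => p Pp.
rewrite -(esum_shift (fun s => f (s - p)%R * g s) Lz (PL _ Pp)).
by apply: eq_esum => s _; rewrite addrK.
Qed.

(* The weight [q] averages over each coset of [P], so that the sum over cosets
   of [P] can be written as a sum over [L] without choosing representatives. *)
Lemma esum_coset_average L P f g (q : V -> \bar R) :
  zmod_closed (mem L) -> zmod_closed (mem P) -> P `<=` L ->
  (forall z, 0 <= f z) -> (forall z, 0 <= g z) -> (forall z, 0 <= q z) ->
  (forall s, L s -> coset_sum P q s = 1) ->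
  \esum_(s in L) f s * coset_sum P g s =
  \esum_(s in L) q s * (coset_sum P f s * coset_sum P g s).
Proof.
move=> Lz Pz PL f0 g0 q0 q1.
transitivity (\esum_(s in L) (f s * coset_sum P g s) * coset_sum P q s).
  by apply: eq_esum => s Ls; rewrite q1// mule1.
(* Adjointness moves the coset sum from [q] onto [f * coset_sum P g]; the second factor is constant
   on cosets and comes out of the sum. *)
rewrite coset_sum_adjoint//; last first.
  by move=> z; rewrite mule_ge0// coset_sum_ge0.
apply: eq_esum => s Ls; rewrite [RHS]muleC; congr (_ * _).
rewrite [X in X * _]/coset_sum -ge0_esumZr ?coset_sum_ge0//.
by apply: eq_esum => p Pp; rewrite coset_sum_shift.
Qed.

(** After averaging, each form is a [q]-weighted sum of products of coset sums, so AM-GM applies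
    term by term. The form without subtraction remains meaningful for infinite sums. *)
Lemma coset_kernel_psd L P f g (q : V -> \bar R) :
  zmod_closed (mem L) -> zmod_closed (mem P) -> P `<=` L ->
  (forall z, 0 <= f z) -> (forall z, 0 <= g z) -> (forall z, 0 <= q z) ->
  (forall s, L s -> coset_sum P q s = 1) ->
  \esum_(s in L) f s * coset_sum P g s + \esum_(s in L) f s * coset_sum P g s
  <= \esum_(s in L) f s * coset_sum P f s
     + \esum_(s in L) g s * coset_sum P g s.
Proof.
move=> Lz Pz PL f0 g0 q0 q1; rewrite !(@esum_coset_average L P _ _ q)//.
have cs0 h h' s : (forall z, 0 <= h z) -> (forall z, 0 <= h' z) ->
    0 <= coset_sum P h s * coset_sum P h' s.
  by move=> *; rewrite mule_ge0 ?coset_sum_ge0.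
rewrite -!esumD; try by move=> s _; rewrite mule_ge0// cs0.
apply: le_esum => s _.
rewrite -(ge0_muleDr (q s)) ?cs0// -(ge0_muleDr (q s)) ?cs0//.
by rewrite lee_wpmul2l// mule_double_le_sqr ?coset_sum_ge0.
Qed.

End CosetSums.

(** * Gaussian product identity and lattices in coordinates *)

Section Gaussians.
Variables (R : realType) (n : nat).
Implicit Types (x y w : 'rV[R]_n) (L M : set 'rV[R]_n).

Definition sqnorm x : R := \sum_(i < n) x ord0 i ^+ 2.

Lemma gaussianE x : gaussian x = expR (- pi * sqnorm x).
Proof. by rewrite /gaussian sqr_sqrtr// sumr_ge0// => i _; exact: sqr_ge0. Qed.

Lemma gaussian_gt0 x : 0 < gaussian x.
Proof. exact: expR_gt0. Qed.

(** The halved exponent absorbs the factor 2 of the parallelogram law. *)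
Definition wide_gaussian x : R := expR (- (pi / 2) * sqnorm x).

Lemma gaussianN x : gaussian (- x) = gaussian x.
Proof.
rewrite !gaussianE; congr (expR (_ * _)).
by apply: eq_bigr => i _; rewrite !mxE sqrrN.
Qed.

Lemma gaussianM x y :
  gaussian x * gaussian y = wide_gaussian (x + y) * wide_gaussian (x - y).
Proof.
rewrite !gaussianE -!expRD -!mulrDr; congr expR.
rewrite mulNr mulNr -mulrA; congr (- (_ * _)).
rewrite -!big_split mulr_sumr; apply: eq_bigr => i _ /=.
by rewrite !mxE; field.
Qed.

(** Exponentiated, this bounds the Gaussian at a lattice point by a constant times a product of
    one-dimensional factors [expR (- |y_i|)]. It holds because [y] depends affinely on [y *m B + x],
    and a quadratic dominates a linear function. *)
Lemma norm_row_le_sqnorm (B : 'M[R]_n) x : row_free B ->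
  exists C : R, forall y : 'rV[R]_n,
    \sum_(i < n) `|y ord0 i| <= pi * sqnorm (y *m B + x) + C.
Proof.
move=> Bfree; have Bunit : B \in unitmx by rewrite -row_free_unit.
pose D : R := \sum_(i < n) \sum_(j < n) `|invmx B j i|.
have D0 : 0 <= D by do 2![apply: sumr_ge0 => ? _].
(* Per coordinate, [|v - x| D <= |v| D + |x| D], and [|v| D <= pi |v|^2 + D^2] follows from
   [(|v| - D)^2 >= 0]. *)
exists (\sum_(j < n) (D ^+ 2 + D * `|x ord0 j|)) => y.
set v := (y *m B + x).
have yE : y = (v - x) *m invmx B by rewrite addrK mulmxK.
apply: (@le_trans _ _ (\sum_(j < n) `|v ord0 j - x ord0 j| * D)).
  have -> : (\sum_(j < n) `|v ord0 j - x ord0 j| * D =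
      \sum_(i < n) \sum_(j < n) `|v ord0 j - x ord0 j| *
        \sum_(k < n) `|invmx B k i|).
    by rewrite exchange_big/=; apply: eq_bigr => j _; rewrite mulr_sumr.
  apply: ler_sum => i _; rewrite yE mxE; apply: le_trans (ler_norm_sum _ _ _) _.
  apply: ler_sum => j _; rewrite normrM !mxE ler_wpM2l// (bigD1 j)//= lerDl.
  exact: sumr_ge0.
rewrite /sqnorm mulr_sumr -big_split/=; apply: ler_sum => j _.
have := ler_normB (v ord0 j) (x ord0 j); have := pi_ge2 R.
have := sqr_ge0 (`|v ord0 j| - D); rewrite -(real_normK (num_real (v ord0 j))).
set a := `|v ord0 j|; set b := `|x ord0 j|; set c := `|_ - _| => h p2 h'.
have : c * D <= a * D + b * D by rewrite -mulrDl ler_wpM2r.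
have : 2 * a ^+ 2 <= pi * a ^+ 2 by rewrite ler_wpM2r ?sqr_ge0.
have := sqr_ge0 a; have := sqr_ge0 D; move: h; rewrite sqrrB; lra.
Qed.

(** In matrix form, closure under subtraction and uniqueness of coordinates become matrix
    algebra. *)
Lemma lattice_rowE (B : 'M[R]_n) :
  [set \sum_(i < n) (z i)%:~R *: row i B | z in [set: 'I_n -> int]] =
  [set map_mx intr z *m B | z in [set: 'rV[int]_n]].
Proof.
apply/seteqP; split=> _ [z _ <-].
- exists (\row_i z i) => //; rewrite mulmx_sum_row.
  by apply: eq_bigr => i _; rewrite !mxE.
- exists (z ord0) => //; rewrite mulmx_sum_row.
  by apply: eq_bigr => i _; rewrite !mxE.
Qed.

Lemma lattice_zmod_closed L : is_lattice L -> zmod_closed (mem L).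
Proof.
move=> [B _ ->]; rewrite lattice_rowE; split.
  by rewrite inE; exists 0 => //; rewrite map_mx0 mul0mx.
move=> _ _ /[!inE] -[y _ <-] [z _ <-]; exists (y - z) => //.
by rewrite map_mxB mulmxBl.
Qed.

Local Open Scope ereal_scope.

(** The subgroup [2M], by whose elements [w + m] and [w - m] differ. *)
Definition doubled M := [set (m + m)%R | m in M].

Lemma doubled_inj : injective (fun x => x + x)%R.
Proof.
move=> x y /rowP h; apply/rowP => i; move: (h i); rewrite !mxE => {}h; lra.
Qed.

Lemma doubled_zmod_closed M :
  zmod_closed (mem M) -> zmod_closed (mem (doubled M)).
Proof.
move=> Mz; have [M0 MB] := Mz; split.
  by rewrite inE; exists 0%R; [rewrite -in_setE|rewrite addr0].
move=> _ _ /[!inE] -[u Mu <-] [v Mv <-]; exists (u - v)%R.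
  by rewrite -in_setE; apply: MB; rewrite inE.
by rewrite opprD addrACA.
Qed.

Lemma doubled_subset L M : zmod_closed (mem L) -> M `<=` L ->
  doubled M `<=` L.
Proof.
by move=> Lz ML _ [m /ML Lm <-]; exact: mem_zmod_closedD.
Qed.

Lemma coset_sum_doubled M (h : 'rV[R]_n -> \bar R) s : zmod_closed (mem M) ->
  coset_sum (doubled M) h s = \esum_(m in M) h (s - (m + m))%R.
Proof.
move=> Mz; rewrite /coset_sum esum_image; last first.
  by move=> x y _ _; exact: doubled_inj.
rewrite -(esum_opp _ Mz); apply: eq_esum => m _.
by rewrite opprD.
Qed.

Definition shifted_wide_gaussian x w : \bar R := (wide_gaussian (w + x))%:E.

Lemma shifted_wide_gaussian_ge0 x w : 0 <= shifted_wide_gaussian x w.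
Proof. by rewrite lee_fin expR_ge0. Qed.

(** For fixed [m], put [s = w + m]; then [s - 2m = w - m], and the terms agree by the parallelogram
    law. *)
Lemma esum_gaussianM L M x y : zmod_closed (mem L) -> zmod_closed (mem M) ->
  M `<=` L ->
  (\esum_(w in L) (gaussian (w + x))%:E) *
    (\esum_(m in M) (gaussian (m + y))%:E) =
  \esum_(s in L) shifted_wide_gaussian (x + y) s *
    coset_sum (doubled M) (shifted_wide_gaussian (x - y)) s.
Proof.
move=> Lz Mz ML.
have g0 (z : 'rV[R]_n) : 0 <= (gaussian z)%:E.
  by rewrite lee_fin ltW ?gaussian_gt0.
have sg0 z w := shifted_wide_gaussian_ge0 z w.
rewrite -ge0_esumZr//; last exact: esum_ge0.
under eq_esum do rewrite -ge0_esumZl//.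
under [RHS]eq_esum do rewrite coset_sum_doubled// -ge0_esumZl//.
rewrite exchange_esum; last by move=> *; rewrite mule_ge0.
rewrite [RHS]exchange_esum; last by move=> *; rewrite mule_ge0.
apply: eq_esum => m Mm.
rewrite -[RHS](esum_shift _ Lz (ML _ Mm)); apply: eq_esum => w _.
rewrite -!EFinM gaussianM; congr (wide_gaussian _ * wide_gaussian _)%:E.
  by rewrite addrACA.
by rewrite opprD addrACA; congr (_ + _)%R; rewrite opprD addrA addrK.
Qed.

End Gaussians.

(** * Finiteness of Gaussian sums over lattices *)

Section LatticeSummability.
Variable R : realType.
Local Open Scope ereal_scope.

Lemma esum_expRN_lty : \esum_(k in [set: nat]) (expR (- k%:R) : R)%:E < +oo.
Proof.
set q : R := expR (- 1).
have q1 : (q < 1)%R by rewrite expR_lt1 ltrN10.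
rewrite -nneseries_esumT => [|k]; last by rewrite lee_fin expR_ge0.
(* The geometric series of ratio [q] bounds every partial sum. *)
apply: (@le_lt_trans _ _ (1 / (1 - q))%:E); last exact: ltry.
apply: lime_le.
  by apply: is_cvg_nneseries => k _ _; rewrite lee_fin expR_ge0.
apply: nearW => N; rewrite sumEFin lee_fin.
apply: le_trans (@geometric_le_lim _ N 1 q ler01 (expR_gt0 _) _).
  rewrite /series/= le_eqVlt; apply/orP; left; apply/eqP.
  by apply: eq_bigr => k _; rewrite mul1r /q -expRM_natl mulrN1.
by rewrite gtr0_norm ?expR_gt0.
Qed.

Lemma esum_int_expRN_lty :
  \esum_(k in [set: int]) (expR (- `|k%:~R|) : R)%:E < +oo.
Proof.
have g0 (k : int) : 0 <= (expR (- `|k%:~R|) : R)%:E by rewrite lee_fin expR_ge0.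
rewrite (esumID [set Posz m | m in [set: nat]])//.
have -> : [set: int] `&` ~` [set Posz m | m in [set: nat]] =
    [set Negz m | m in [set: nat]].
  apply/seteqP; split=> [[m|m] [_ h]|_ [m _ <-]].
  - by exfalso; apply: h; exists m.
  - by exists m.
  - by split=> // -[].
rewrite setTI !esum_image; [|by move=> ? ? _ _ []..].
apply: lte_add_pinfty.
  apply: le_lt_trans esum_expRN_lty; apply: le_esum => m _.
  by rewrite -pmulrn normr_nat.
(* [Negz m] is [-(m + 1)], so its term is at most the one of index [m]. *)
apply: le_lt_trans esum_expRN_lty; apply: le_esum => m _.
by rewrite NegzE mulrNz normrN -pmulrn normr_nat lee_fin ler_expR lerN2 ler_nat.
Qed.

(** By induction on [n]: splitting off the first coordinate factors the sum into the one-dimensional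
    sum and the sum over shorter rows. *)
Lemma esum_prod_lty (V : zmodType) (g : V -> R) n : (forall t, 0 <= g t)%R ->
  \esum_(t in [set: V]) (g t)%:E < +oo ->
  \esum_(z in [set: 'rV[V]_n]) (\prod_(i < n) g (z ord0 i))%:E < +oo.
Proof.
move=> g0 gfin; elim: n => [|n IHn].
  rewrite (_ : [set: 'rV[V]_0] = [set 0%R]).
    by rewrite esum_set1 ?big_ord0 ?ltry ?lee_fin.
  by apply/seteqP; split=> // z _; apply/rowP => -[].
have p0 m (z : 'rV[V]_m) : 0 <= (\prod_(i < m) g (z ord0 i))%:E.
  by rewrite lee_fin; apply: prodr_ge0.
(* The bijection that prepends a first coordinate to a row. *)
pose e (tz : V * 'rV[V]_n) : 'rV[V]_n.+1 :=
  (\row_i if unlift ord0 i is Some j then tz.2 ord0 j else tz.1)%R.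
have e0 tz : e tz ord0 ord0 = tz.1 by rewrite mxE unlift_none.
have eS tz j : e tz ord0 (lift ord0 j) = tz.2 ord0 j by rewrite mxE liftK.
rewrite (reindex_esum ([set: V] `*`` fun=> [set: 'rV[V]_n]) _ e); last first.
  split=> //.
  - move=> [t z] [t' z'] _ _ /rowP h; congr pair.
      by have := h ord0; rewrite !e0.
    by apply/rowP => j; have := h (lift ord0 j); rewrite !eS.
  - move=> z _; exists (z ord0 ord0, \row_j z ord0 (lift ord0 j))%R => //.
    apply/rowP => i; case: (unliftP ord0 i) => [j ->|->]; last by rewrite e0.
    by rewrite eS mxE.
rewrite (eq_esum (b := fun tz : V * 'rV[V]_n =>
    (g tz.1)%:E * (\prod_(i < n) g (tz.2 ord0 i))%:E)); last first.
  move=> tz _; rewrite big_ord_recl e0 EFinM.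
  by congr (_ * _%:E); apply: eq_bigr => i _; rewrite eS.
rewrite -(@esum_esum _ _ _ [set: V] (fun=> [set: 'rV[V]_n])
  (fun t z => (g t)%:E * (\prod_(i < n) g (z ord0 i))%:E)); last first.
  by move=> *; rewrite mule_ge0// lee_fin.
under eq_esum do rewrite (ge0_esumZl _ _ (p0 n)) ?lee_fin//.
rewrite ge0_esumZr ?esum_ge0//.
have S0 : 0 <= \esum_(t in [set: V]) (g t)%:E.
  by apply: esum_ge0 => t _; rewrite lee_fin.
by apply: lte_mul_pinfty IHn => //; rewrite ge0_fin_numE.
Qed.

(** In integer coordinates the Gaussian is dominated by [expR C] times a product of summable
    factors. *)
Lemma lattice_gaussian_lty n (L : set 'rV[R]_n) (x : 'rV[R]_n) :
  is_lattice L -> \esum_(w in L) (gaussian (w + x))%:E < +oo.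
Proof.
move=> [B Bfree ->]; rewrite lattice_rowE.
have [C hC] := norm_row_le_sqnorm x Bfree.
rewrite esum_image; last first.
  move=> y z _ _ /(row_free_inj Bfree) /rowP h; apply/rowP => i.
  by move: (h i); rewrite !mxE => /intr_inj.
have g0 (k : int) : (0 <= expR (- `|k%:~R|) :> R)%R by exact: expR_ge0.
apply: (@le_lt_trans _ _ (\esum_(z in [set: 'rV[int]_n])
    ((expR C)%:E * (\prod_(i < n) expR (- `|(z ord0 i)%:~R|))%:E))).
  apply: le_esum => z _; rewrite -EFinM lee_fin gaussianE -expR_sum -expRD.
  rewrite ler_expR sumrN; have := hC (map_mx intr z).
  by under eq_bigr do rewrite mxE; lra.
rewrite ge0_esumZl ?lee_fin ?expR_ge0//; last first.
  by move=> z; rewrite lee_fin; apply: prodr_ge0.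
rewrite lte_mul_pinfty ?lee_fin ?expR_ge0//.
exact: (esum_prod_lty _ g0 esum_int_expRN_lty).
Qed.

End LatticeSummability.

(** * Comparison of the Gaussian masses of a lattice and a sublattice *)

Section Monotonicity.
Variables (R : realType) (n : nat).
Implicit Types (x y w : 'rV[R]_n) (K L M : set 'rV[R]_n).
Local Open Scope ereal_scope.

Let gaussian_ge0 x : 0 <= (gaussian x)%:E.
Proof. by rewrite lee_fin ltW ?gaussian_gt0. Qed.

Lemma gaussian_mass_shift K x :
  gaussian_mass [set (w + x)%R | w in K] =
  \esum_(w in K) (gaussian (w + x))%:E.
Proof. by rewrite /gaussian_mass esum_image// => u v _ _ /addIr. Qed.

Lemma esum_gaussianB K x : zmod_closed (mem K) ->
  \esum_(w in K) (gaussian (w - x))%:E = \esum_(w in K) (gaussian (w + x))%:E.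
Proof.
move=> Kz; rewrite -(esum_opp _ Kz); apply: eq_esum => w _.
by rewrite -opprD gaussianN.
Qed.

Lemma sub_gaussian_lty K L x : is_lattice L -> K `<=` L ->
  \esum_(w in K) (gaussian (w + x))%:E < +oo.
Proof.
move=> hL /setIidPr KL; apply: le_lt_trans (lattice_gaussian_lty x hL).
by rewrite [leRHS](esumID K)// KL leeDl// esum_ge0.
Qed.

Lemma esum_gaussian_gt0 K x : zmod_closed (mem K) ->
  0 < \esum_(w in K) (gaussian (w + x))%:E.
Proof.
move=> [/[!inE] K0 _].
apply: (@lt_le_trans _ _ (gaussian (0 + x)%R)%:E).
  by rewrite lte_fin gaussian_gt0.
apply: esum_ge; exists [set 0%R]; last by rewrite fsbig_set1.
by split; [exact: finite_set1|move=> _ ->].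
Qed.

(** Positivity of the kernel modulo [2M] is applied to the wide Gaussians shifted by [x] and [- x].
    The cross term is the left side here; both diagonal terms equal the right side, by symmetry of
    [L]. *)
Lemma gaussian_correlation L M x : is_lattice L -> is_sublattice M L ->
  (\esum_(w in L) (gaussian w)%:E) * (\esum_(m in M) (gaussian (m + x))%:E) <=
  (\esum_(w in L) (gaussian (w + x))%:E) * (\esum_(m in M) (gaussian m)%:E).
Proof.
move=> hL [ML Mz]; have Lz := lattice_zmod_closed hL.
have Pz := doubled_zmod_closed Mz; have PL := doubled_subset Lz ML.
pose c s := coset_sum (doubled M) (fun w => (gaussian w)%:E) s.
have cE s : c s = \esum_(p in doubled M) (gaussian (p + s))%:E.
  by apply: eq_esum => p _; rewrite addrC.
have c_gt0 s : 0 < c s by rewrite cE esum_gaussian_gt0.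
have c_fin s : c s \is a fin_num.
  by rewrite ge0_fin_numE ?ltW// cE (sub_gaussian_lty _ hL).
have fc_gt0 s : (0 < fine (c s))%R by rewrite -lte_fin fineK.
(* The Gaussian divided by its own sum over the coset of [s], so that the weights on each coset add
   up to 1. *)
pose q s := (gaussian s)%:E * ((fine (c s))^-1)%:E.
have q0 s : 0 <= q s by rewrite mule_ge0// lee_fin invr_ge0 ltW.
have q1 s : L s -> coset_sum (doubled M) q s = 1.
  move=> _; have cS p : doubled M p -> c (s + p)%R = c s.
    exact: coset_sum_shift.
  rewrite /coset_sum /q; under eq_esum => p Pp do rewrite (cS p Pp).
  rewrite ge0_esumZr ?lee_fin ?invr_ge0 ?ltW//.
  rewrite [X in X * _](_ : _ = (fine (c s))%:E); last by rewrite fineK.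
  by rewrite -EFinM mulfV ?gt_eqF.
have := coset_kernel_psd Lz Pz PL (shifted_wide_gaussian_ge0 x)
  (shifted_wide_gaussian_ge0 (- x)%R) q0 q1.
have := esum_gaussianM 0%R x Lz Mz ML; rewrite add0r sub0r => <-.
have := esum_gaussianM x 0%R Lz Mz ML; rewrite addr0 subr0 => <-.
have := esum_gaussianM (- x)%R 0%R Lz Mz ML; rewrite addr0 subr0 => <-.
rewrite esum_gaussianB//.
under [X in X * _ + _ <= _]eq_esum do rewrite addr0.
under [X in _ + X * _ <= _]eq_esum do rewrite addr0.
under [X in _ <= _ * X + _]eq_esum do rewrite addr0.
under [X in _ <= _ + _ * X]eq_esum do rewrite addr0.
(* The inequality is now [a + a <= b + b]; the factor 2 is removed by contraposition, since [b < a]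
   would give [b + b < a + a]. *)
by move=> h; rewrite leNgt; apply: contraL h => h; rewrite -ltNge lteD.
Qed.

End Monotonicity.

Theorem proposition4p3 (R : realType) (n : nat) (L M : set 'rV[R]_n)
    (hL : is_lattice L) (hM : is_sublattice M L) (x : 'rV[R]_n) :
  periodic_gaussian M x <= periodic_gaussian L x.
Proof.
have [ML Mz] := hM; have Lz := lattice_zmod_closed hL.
(* Finiteness makes [fine] faithful on all four masses. *)
have fin K y : K `<=` L ->
    (\esum_(w in K) (gaussian (w + y))%:E)%E \is a fin_num.
  move=> KL; rewrite ge0_fin_numE ?(sub_gaussian_lty _ hL)//.
  by apply: esum_ge0 => w _; rewrite lee_fin ltW ?gaussian_gt0.
have mass0 K : gaussian_mass K = (\esum_(w in K) (gaussian (w + 0))%:E)%E.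
  by apply: eq_esum => w _; rewrite addr0.
have pos K : K `<=` L -> zmod_closed (mem K) -> 0 < fine (gaussian_mass K).
  by move=> KL Kz; rewrite -lte_fin mass0 fineK ?fin// esum_gaussian_gt0.
rewrite /periodic_gaussian !gaussian_mass_shift.
(* Clearing the two positive denominators leaves exactly the correlation inequality. *)
rewrite ler_pdivrMr ?pos// mulrAC ler_pdivlMr ?pos//.
rewrite -lee_fin !EFinM !fineK ?mass0 ?fin//.
by rewrite muleC -!mass0 gaussian_correlation.
Qed.
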